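(* (i) For a policy $\pi:\mathcal{X}\to\Delta(\mathcal{A})$, let $\bar\pi$ be its extension to the augmented MDP. Then for all $x\in\mathcal{X}$, $a\in\mathcal{A}$, $$Q^\pi(x,a)\ge\bar Q^{\bar\pi}(x,a),\qquad V^\pi(x)=\bar V^{\bar\pi}(x).$$ (ii) Conversely, for a policy $\xi:\bar{\mathcal{X}}\to\Delta(\bar{\mathcal{A}})$, define its restriction $\underline{\xi}$ on $\mathcal{X}$ and $\mathcal{A}$ by redistributing the probability that $\xi$ puts on $a^+$ uniformly over $\mathcal{A}$. Then for all $x\in\mathcal{X}$, $a\in\mathcal{A}$, $$Q^{\underline\xi}(x,a)\ge\bar Q^{\xi}(x,a),\qquad V^{\underline\xi}(x)\ge\bar V^{\xi}(x).$$
   Context: **Setting.** State space $\mathcal{S}$, action space $\mathcal{A}$ (on which a uniform distribution is presupposed in part (ii)), context space $\mathcal{C}$, transition kernel $P:\mathcal{S}\times\mathcal{A}\to\Delta(\mathcal{S})$, discount $\gamma\in[0,1)$, and for each $c\in\mathcal{C}$ a goal set $G_c\subset\mathcal{S}$. $\Delta(\cdot)$ denotes the space of distributions. $\mathcal{X}=\mathcal{S}\times\mathcal{C}$, $G=\{(s,c)\in\mathcal{X}:s\in G_c\}$; $s^+\notin\mathcal{S}$ is a fictitious absorbing state, $\bar{\mathcal{X}}=(\mathcal{S}\cup\{s^+\})\times\mathcal{C}$, $\mathcal{X}^+=\{(s^+,c):c\in\mathcal{C}\}$. $R(x)=\mathbb{1}(x\in G)$ (zero on $\mathcal{X}^+$).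 **Original MDP.** Contexts never change. From $(s,c)$ with $s\in G_c$ or $s=s^+$, every action in $\mathcal{A}$ leads to $(s^+,c)$; otherwise action $a$ leads to $(s',c)$ with $s'\sim P(\cdot|s,a)$. For $\pi:\mathcal{X}\to\Delta(\mathcal{A})$ (actions on $\mathcal{X}^+$ are irrelevant), $Q^\pi(x,a)=\mathbb{E}_{\pi,P}[\sum_{t\ge0}\gamma^tR(x_t)\mid x_0=x,a_0=a]$ and $V^\pi(x)=Q^\pi(x,\pi)$, where $f(x,\pi)=\mathbb{E}_{a\sim\pi(\cdot|x)}[f(x,a)]$. **Augmented MDP.** Actions $\bar{\mathcal{A}}=\mathcal{A}\cup\{a^+\}$ with $a^+\notin\mathcal{A}$ fictitious. Reward $\bar R(x,a)=\mathbb{1}(s\in G_c)\mathbb{1}(a=a^+)$ for $x=(s,c)\in\mathcal{X}$, and $0$ on $\mathcal{X}^+$. Transition $\bar P$: from $x=(s,c)\in\mathcal{X}$, action $a^+$ leads to $(s^+,c)$, and action $a\in\mathcal{A}$ leads to $(s',c)$ with $s'\sim P(\cdot|s,a)$ (also when $x\in G$); states in $\mathcal{X}^+$ are terminal (absorbing). For a policy $\bar\pi:\bar{\mathcal{X}}\to\Delta(\bar{\mathcal{A}})$, $\bar Q^{\bar\pi}(x,a)=\mathbb{E}_{\bar\pi,\bar P}[\sum_{t\ge0}\gamma^t\bar R(x_t,a_t)\mid x_0=x,a_0=a]$ and $\bar V^{\bar\pi}(x)=\bar Q^{\bar\pi}(x,\bar\pi)$. **Extension.** For $\pi:\mathcal{X}\to\Delta(\mathcal{A})$,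 $\bar\pi(\cdot|x)=\pi(\cdot|x)$ for $x\in\mathcal{X}\setminus G$ and $\bar\pi$ plays $a^+$ with probability one for $x\in G$ (its choice on $\mathcal{X}^+$ is irrelevant). *)

(* Defs.v *)
From HB Require Import structures.
From mathcomp Require Import all_boot all_order all_algebra.
From mathcomp Require Import all_classical all_reals all_analysis.
From mathcomp Require Import measurable_realfun.

Set Implicit Arguments.
Unset Strict Implicit.
Unset Printing Implicit Defensive.
Import Order.TTheory GRing.Theory Num.Theory.
Import numFieldNormedType.Exports.

Local Open Scope classical_set_scope.
Local Open Scope ring_scope.
Local Open Scope ereal_scope.

(* A measurable family of probability measures, packaged as a probability
   kernel. *)
Section pker_of.
Context d d' (X : measurableType d) (Y : measurableType d') (R : realType).
Variable k : X -> {measure set Y -> \bar R}.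

Definition pker_of
  (mk : forall U, measurable U -> measurable_fun [set: X] (k ^~ U))
  (k1 : forall x, k x [set: Y] = 1) : X -> {measure set Y -> \bar R} := k.

Hypothesis mk : forall U, measurable U -> measurable_fun [set: X] (k ^~ U).
Hypothesis k1 : forall x, k x [set: Y] = 1.

HB.instance Definition _ := isKernel.Build _ _ _ _ _ (pker_of mk k1) mk.
HB.instance Definition _ :=
  Kernel_isProbability.Build _ _ _ _ _ (pker_of mk k1) k1.
End pker_of.

Section push.
Context d d' (X : measurableType d) (Y : measurableType d') (R : realType).
Variables (f : X -> Y) (mf : measurable_fun [set: X] f).
Variable m : {measure set X -> \bar R}.

Definition push_fun (_ : measurable_fun [set: X] f) : set Y -> \bar R :=
  pushforward m f.

Let push_fun0 : push_fun mf set0 = 0.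
Proof. by rewrite /push_fun /pushforward preimage_set0 measure0. Qed.

Let push_fun_ge0 U : 0 <= push_fun mf U. Proof. exact: measure_ge0. Qed.

Let push_fun_sigma_additive : semi_sigma_additive (push_fun mf).
Proof.
move=> F mF tF mUF; rewrite /push_fun /pushforward preimage_bigcup.
have mfF B : measurable B -> measurable (f @^-1` B).
  by move=> mB; rewrite -[X in measurable X]setTI; exact: mf.
apply: measure_semi_sigma_additive.
- by move=> n; exact: mfF.
- apply/trivIsetP => /= i j _ _ ij; rewrite -preimage_setI.
  by move/trivIsetP : tF => /(_ _ _ _ _ ij) ->//; rewrite preimage_set0.
- by rewrite -preimage_bigcup; exact: mfF.
Qed.

HB.instance Definition _ := isMeasure.Build _ _ R (push_fun mf)
  push_fun0 push_fun_ge0 push_fun_sigma_additive.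

Definition push : {measure set Y -> \bar R} := push_fun mf.

Lemma push_prob : m setT = 1 -> push setT = 1.
Proof. by move=> m1; rewrite /push/= /push_fun /pushforward preimage_setT. Qed.
End push.
Arguments push {d d' X Y R f} mf m.
Arguments push_prob {d d' X Y R f} mf m.

Section kernel_precomposition.
Context d d' d'' (W : measurableType d'') (X : measurableType d)
  (Y : measurableType d') (R : realType).
Variables (k : R.-pker X ~> Y) (f : W -> X) (mf : measurable_fun setT f).

Lemma measurable_kprecomp U : measurable U ->
  measurable_fun [set: W] (fun w => k (f w) U).
Proof.
by move=> mU; exact: (measurableT_comp (measurable_kernel k U mU) mf).
Qed.

Definition kprecomp : R.-pker W ~> Y :=
  pker_of measurable_kprecomp (fun w => prob_kernel (f w)).
End kernel_precomposition.

Section kernel_composition.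
Context d1 d2 d3 (X : measurableType d1) (Y : measurableType d2)
  (Z : measurableType d3) (R : realType).
Variables (l : R.-pker X ~> Y) (k : R.-pker (X * Y) ~> Z).

Lemma pkcomp_prob x : mkcomp l k x [set: Z] = 1.
Proof.
rewrite /mkcomp/= /kcomp; under eq_integral do rewrite prob_kernel.
by rewrite integral_cst// prob_kernel mule1.
Qed.

Definition pkcomp : R.-pker X ~> Z :=
  pker_of (measurable_kernel (mkcomp l k)) pkcomp_prob.
End kernel_composition.

(* Trajectories (z_0, z_1, ...) in Z, with the product sigma-algebra. *)
Definition coordinate_cylinders d (Z : measurableType d) :
    set (set (nat -> Z)) :=
  [set A | exists n, exists2 B : set Z, measurable B & A = [set w | B (w n)]].

Arguments coordinate_cylinders {d} Z _.

Definition trajectories d (Z : measurableType d) :=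
  g_sigma_algebraType (coordinate_cylinders Z).

HB.instance Definition _ d (Z : measurableType d) :=
  Measurable.copy (trajectories Z)
    (g_sigma_algebraType (coordinate_cylinders Z)).

Section trajectories.
Context d (Z : measurableType d).

Lemma measurable_coordinate n :
  measurable_fun setT (fun w : trajectories Z => w n).
Proof.
by move=> _ B mB; rewrite setTI; apply: sub_sigma_algebra; exists n, B.
Qed.

Lemma measurable_fun_trajectories d' (T : measurableType d')
    (f : T -> trajectories Z) :
  (forall n, measurable_fun setT (fun t => f t n)) -> measurable_fun setT f.
Proof.
move=> mf; apply: (@measurability _ _ T (trajectories Z) setT f
  (coordinate_cylinders Z)) => //.
move=> _ [_ [n [B mB ->]] <-]; rewrite setTI -[X in measurable X]setTI.
exact: mf.
Qed.

Definition update (n : nat) (wz : trajectories Z * Z) : trajectories Z :=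
  fun i => if i == n then wz.2 else wz.1 i.

Lemma measurable_update n : measurable_fun setT (update n).
Proof.
apply: measurable_fun_trajectories => i; rewrite /update.
case: (i == n); first exact: measurable_snd.
exact: (measurableT_comp (measurable_coordinate i) measurable_fst).
Qed.

(* A only depends on the coordinates 0, ..., n. *)
Definition prefix_dependent (n : nat) (A : set (trajectories Z)) :=
  forall w w' : trajectories Z,
    (forall i, (i <= n)%N -> w i = w' i) -> A w -> A w'.

Lemma prefix_dependentW m n A : (m <= n)%N ->
  prefix_dependent m A -> prefix_dependent n A.
Proof.
by move=> mn pA w w' ww'; apply: pA => i im; apply: ww'; exact: leq_trans mn.
Qed.

Definition cylinder (A : set (trajectories Z)) :=
  measurable A /\ exists n, prefix_dependent n A.

End trajectories.

Definition cylinder_display : measure_display -> measure_display.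
Proof. by []. Qed.
Definition cylinders_of d (Z : measurableType d) := nat -> Z.

Section cylinder_algebra.
Context d (Z : measurableType d).

Lemma cylinder0 : cylinder (set0 : set (trajectories Z)).
Proof. by split => //; exists 0%N. Qed.

Lemma cylinderC (A : set (trajectories Z)) : cylinder A -> cylinder (~` A).
Proof.
move=> [mA [n pA]]; split; first exact: measurableC.
by exists n => w w' ww' nA Aw'; apply: nA; apply: pA Aw' => i /ww' ->.
Qed.

Lemma cylinderU (A B : set (trajectories Z)) :
  cylinder A -> cylinder B -> cylinder (A `|` B).
Proof.
move=> [mA [n pA]] [mB [m pB]]; split; first exact: measurableU.
exists (maxn n m) => w w' ww' [Aw|Bw]; [left|right].
  by apply: (prefix_dependentW (leq_maxl n m) pA) Aw.
by apply: (prefix_dependentW (leq_maxr n m) pB) Bw.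
Qed.

HB.instance Definition _ := Pointed.on (cylinders_of Z).
HB.instance Definition _ := isAlgebraOfSets.Build (cylinder_display d)
  (cylinders_of Z) cylinder0 cylinderU cylinderC.

Lemma sigma_cylinders :
  <<s (measurable : set (set (cylinders_of Z))) >> =
  (measurable : set (set (trajectories Z))).
Proof.
apply/seteqP; split.
  apply: smallest_sub; first exact: sigma_algebra_measurable.
  by move=> A [].
suff : <<s coordinate_cylinders Z >> `<=`
    <<s (measurable : set (set (cylinders_of Z))) >> by [].
apply: smallest_sub; first exact: smallest_sigma_algebra.
move=> _ [n [B mB ->]]; apply: sub_sigma_algebra.
suff : cylinder [set w : trajectories Z | B (w n)] by []; split.
  by apply: sub_sigma_algebra; exists n, B.
by exists n => w w' ww' /=; rewrite ww'.
Qed.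
End cylinder_algebra.

(* [prefix_law k n w] is the law of the trajectory obtained from w by drawing
   the coordinates k+1, ..., k+n successively from K, given w k; the other
   coordinates of w are kept. *)
Section prefix_law.
Context d (Z : measurableType d) (R : realType) (K : R.-pker Z ~> Z).

Fixpoint prefix_law (k n : nat) : R.-pker (trajectories Z) ~> trajectories Z :=
  if n is n'.+1 then
    pkcomp (kprecomp K (measurable_coordinate k))
           (kprecomp (prefix_law k.+1 n') (measurable_update k.+1))
  else kdirac (@measurable_id _ (trajectories Z) setT).

Lemma prefix_lawS k n w A : prefix_law k n.+1 w A =
  \int[K (w k)]_z prefix_law k.+1 n (update k.+1 (w, z)) A.
Proof. by []. Qed.

Lemma prefix_law0 k w A : prefix_law k 0 w A = \d_w A.
Proof. by []. Qed.

Lemma prefix_law_stableS k n w A m : prefix_dependent m A ->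
  (m <= k + n)%N -> prefix_law k n.+1 w A = prefix_law k n w A.
Proof.
move=> pA; elim: n k w => [|n ih] k w mk.
  rewrite prefix_lawS prefix_law0; under eq_integral => z _.
    rewrite prefix_law0 (_ : \d__ A = \d_w A); first over.
    rewrite !diracE; congr (_%:R%:E); congr nat_of_bool.
    apply/idP/idP; rewrite !inE.
      apply: pA => i im; rewrite /update ifF//.
      by apply/negbTE; rewrite neq_ltn ltnS (leq_trans im)// -(addn0 k).
    apply: pA => i im; rewrite /update ifF//.
    by apply/negbTE; rewrite neq_ltn ltnS (leq_trans im)// -(addn0 k).
  by rewrite integral_cst// prob_kernel mule1.
rewrite [LHS]prefix_lawS [RHS]prefix_lawS; apply: eq_integral => z _.
by apply: ih; rewrite addSnnS.
Qed.

Lemma prefix_law_stable k n n' w A m : prefix_dependent m A ->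
  (m <= k + n)%N -> (n <= n')%N -> prefix_law k n' w A = prefix_law k n w A.
Proof.
move=> pA mkn /subnK <-; elim: (n' - n)%N => [//|j ih].
rewrite addSn (prefix_law_stableS _ pA) ?ih//.
by rewrite (leq_trans mkn)// leq_add2l leq_addl.
Qed.

(* The chosen n does not matter: see cylinder_contentE. *)
Definition cylinder_content (w : trajectories Z) (A : set (cylinders_of Z)) :=
  prefix_law 0 (xget 0%N [set n | prefix_dependent n A]) w A.

Lemma cylinder_contentE w A n : prefix_dependent n A ->
  cylinder_content w A = prefix_law 0 n w A.
Proof.
move=> pA; rewrite /cylinder_content.
set m := xget _ _; have pmA : prefix_dependent m A.
  exact: (xgetI 0%N (pA : [set n | prefix_dependent n A] n)).
have [mn|/ltnW nm] := leqP m n.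
  by rewrite (prefix_law_stable (n := m) w pmA).
by rewrite (prefix_law_stable (n := n) w pA).
Qed.

Section content.
Variable w : trajectories Z.

Let cylinder_content_ge0 A : 0 <= cylinder_content w A.
Proof. exact: measure_ge0. Qed.

Let cylinder_content_semi_additive :
  measure_function.semi_additive (cylinder_content w).
Proof.
move=> F n mF tF mUF.
have /choice[p pF] : forall i, exists n, prefix_dependent n (F i).
  by move=> i; have [] := mF i.
pose N := (\max_(i < n) p i)%N.
have pN i : (i < n)%N -> prefix_dependent N (F i).
  move=> ltin; have pN : (p i <= N)%N.
    exact: (@leq_bigmax _ (fun j : 'I_n => p j) (Ordinal ltin)).
  exact: (prefix_dependentW pN (pF i)).
have pU : prefix_dependent N (\big[setU/set0]_(i < n) F i).
  move=> u v uv; rewrite -!bigcup_mkord => -[i/= ltin Fiu].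
  by exists i => //; exact: pN Fiu.
rewrite (cylinder_contentE w pU) measure_semi_additive//=.
- by apply: eq_bigr => i _; rewrite (cylinder_contentE w (pN i (ltn_ord i))).
- by move=> i; exact: (mF i).1.
- exact: mUF.1.
Qed.

HB.instance Definition _ := isContent.Build _ (cylinders_of Z) R
  (cylinder_content w) cylinder_content_ge0 cylinder_content_semi_additive.

End content.

(* Ionescu-Tulcea: a nonincreasing sequence of cylinders whose contents are
   bounded away from 0 has a common point. *)
Section ionescu_tulcea.
Variables (F : (set (cylinders_of Z))^nat) (p : nat -> nat).
Hypothesis mF : forall j, measurable (F j : set (trajectories Z)).
Hypothesis pF : forall j, prefix_dependent (p j) (F j).
Hypothesis niF : nonincreasing_seq F.

Let f k j (w : trajectories Z) := prefix_law k (p j) w (F j).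

Let fS k j w : f k j w = \int[K (w k)]_z f k.+1 j (update k.+1 (w, z)).
Proof.
rewrite /f -(@prefix_law_stable k (p j) (p j).+1 w (F j) (p j)) ?leq_addl//.
Qed.

Let f_le k i j w : (i <= j)%N -> f k j w <= f k i w.
Proof.
move=> ij; pose n := maxn (p i) (p j); rewrite /f.
rewrite -(@prefix_law_stable k (p j) n w (F j) (p j)) ?leq_addl ?leq_maxr//.
rewrite -(@prefix_law_stable k (p i) n w (F i) (p i)) ?leq_addl ?leq_maxl//.
by apply: le_measure; rewrite ?inE//; exact/subsetPset/niF.
Qed.

Let mf k j w :
  measurable_fun [set: Z] (fun z => f k.+1 j (update k.+1 (w, z))).
Proof.
have := measurable_kprecomp (prefix_law k.+1 (p j))
  (@measurable_update _ Z k.+1) (mF j).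
by move=> /(measurable_fun_pair2 w).
Qed.

Let f_step k w (e : R) : (0 < e)%R -> (forall j, e%:E <= f k j w) ->
  exists z, forall j, (e / 2)%:E <= f k.+1 j (update k.+1 (w, z)).
Proof.
move=> e0 ef.
pose B j := [set z | (e / 2)%:E <= f k.+1 j (update k.+1 (w, z))].
have mB j : measurable (B j).
  by rewrite -[B j]setTI; exact: emeasurable_fun_c_infty.
have KB j : (e / 2)%:E <= K (w k) (B j).
  have : e%:E <= (e / 2)%:E + K (w k) (B j).
    apply: (le_trans (ef j)); rewrite fS.
    rewrite [leRHS](_ : _ =
        \int[K (w k)]_z ((e / 2)%:E + (\1_(B j) z)%:E)); last first.
      rewrite ge0_integralD//=.
      - by rewrite integral_cst// prob_kernel mule1 integral_indic// setIT.
      - by move=> z _; rewrite lee_fin divr_ge0// ltW.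
      - by apply/measurable_EFinP; exact: measurable_indic.
    apply: ge0_le_integral => //.
    - apply: emeasurable_funD => //; apply/measurable_EFinP.
      exact: measurable_indic.
    - move=> z _; have [zB|zB] := pselect (B j z).
        rewrite indicE mem_set// (le_trans (y := 1))//.
          rewrite -(prob_kernel (s := prefix_law k.+1 (p j)) (update k.+1 (w, z))).
          by rewrite le_measure ?inE.
        by rewrite -EFinD lee_fin lerDr divr_ge0// ltW.
      by rewrite indicE memNset// adde0; move/negP : zB; rewrite -ltNge => /ltW.
  by rewrite {1}(splitr e) EFinD leeD2lE.
have niB : nonincreasing_seq B.
  by move=> i j ij; apply/subsetPset => z /le_trans; apply; exact: f_le.
have mcapB : measurable (\bigcap_j B j) by exact: bigcap_measurableType.
have Kcap : (e / 2)%:E <= K (w k) (\bigcap_j B j).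
  have cB : K (w k) \o B @ \oo --> K (w k) (\bigcap_j B j).
    apply: nonincreasing_cvg_mu => //; rewrite (@le_lt_trans _ _ 1)// ?ltry//.
    by rewrite -(prob_kernel (s := K) (w k)) le_measure ?inE.
  rewrite -(cvg_lim _ cB)//; apply: lime_ge.
    by apply/cvg_ex; eexists; exact: cB.
  by apply: nearW => j; exact: KB.
have /set0P[z zB] : \bigcap_j B j != set0.
  apply/eqP => B0; move: Kcap; rewrite B0 measure0 lee_fin.
  by apply/negP; rewrite -ltNge divr_gt0.
by exists z => j; exact: zB.
Qed.

Lemma cylinder_content_bigcap w (e : R) : (0 < e)%R ->
  (forall j, e%:E <= cylinder_content w (F j)) -> exists w', forall j, F j w'.
Proof.
move=> e0 eF.
pose P k w' := forall j, (e / 2 ^+ k)%:E <= f k j w'.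
have /choice[zf zfP] : forall kw : nat * trajectories Z, exists z,
    P kw.1 kw.2 -> P kw.1.+1 (update kw.1.+1 (kw.2, z)).
  move=> [k w'] /=; have [Pkw|nP] := pselect (P k w'); last by exists point.
  have [||z Hz] := @f_step k w' (e / 2 ^+ k); rewrite ?divr_gt0 ?exprn_gt0//.
  exists z => _ j; rewrite exprSr invfM mulrA; exact: Hz.
pose ws := fix ws k :=
  if k is k'.+1 then update k (ws k', zf (k', ws k')) else w.
have wsP k : P k (ws k).
  elim: k => [|k ih]; last exact: (zfP (k, ws k)).
  by move=> j; rewrite expr0 divr1 /f -(cylinder_contentE w (@pF j)).
have wsE k i : (i <= k)%N -> ws k i = ws i i.
  elim: k => [|k ih]; first by rewrite leqn0 => /eqP ->.
  rewrite leq_eqVlt => /predU1P[->//|ik].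
  by rewrite -ih// /= {1}/update ifF//; apply/negbTE; rewrite neq_ltn ik.
exists (fun i => ws i i) => j.
have : 0 < f (p j) j (ws (p j)).
  by apply: (lt_le_trans _ (wsP _ j)); rewrite lte_fin divr_gt0// exprn_gt0.
rewrite /f (@prefix_law_stable (p j) 0 (p j) _ (F j) (p j)) ?addn0//.
rewrite prefix_law0 diracE; case: (boolP (_ \in F j)) => [|_];
  last by rewrite ltxx.
rewrite inE => + _; apply: pF => i; exact: wsE.
Qed.

End ionescu_tulcea.

Lemma cylinder_content_sigma_subadditive w :
  measurable_subset_sigma_subadditive (cylinder_content w).
Proof.
move=> D A mA mD DA.
have /choice[p pA] : forall i, exists n, prefix_dependent n (A i).
  by move=> i; have [] := mA i.
pose E n := D `\` \big[setU/set0]_(i < n) A i.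
have mE n : measurable (E n).
  by apply: measurableD => //; exact: bigsetU_measurable.
have niE : nonincreasing_seq E.
  move=> m n mn; apply/subsetPset => u [Du nAu]; split => //.
  apply: contra_not nAu; rewrite -!bigcup_mkord => -[i/= im Aiu].
  by exists i => //=; exact: leq_trans mn.
have /choice[q qE] : forall i, exists n, prefix_dependent n (E i).
  by move=> i; have [] := mE i.
apply/lee_addgt0Pr => e e0.
have [n En] : exists n, cylinder_content w (E n) < e%:E.
  apply: contrapT => /forallNP nE.
  have [|w' Ew'] :=
    cylinder_content_bigcap (fun j => (mE j).1) qE niE e0 (w := w).
    by move=> j; rewrite leNgt; exact/negP/nE.
  have [i _ Aiw'] := DA _ (Ew' 0%N).1.
  by case: (Ew' i.+1) => _; apply; rewrite -bigcup_mkord; exists i => //=.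
have DE : D `<=` \big[setU/set0]_(i < n.+1)
    (if (i : nat) is i'.+1 then A i' else E n).
  move=> u Du; rewrite big_ord_recl/=.
  have [Au|nAu] := pselect ((\big[setU/set0]_(i < n) A i) u); first by right.
  by left.
have := @content_subadditive _ _ _ (cylinder_content w) D
  (fun i => if (i : nat) is i'.+1 then A i' else E n) n.+1.
move=> /(_ _ mD DE) => h; apply: (le_trans (h _)).
  by move=> [|i] _ //.
rewrite big_ord_recl/= addeC; apply: leeD; last exact: ltW.
rewrite -(big_mkord xpredT (fun i => cylinder_content w (A i))).
by apply: nneseries_lim_ge => i _ _; exact: measure_ge0.
Qed.

HB.instance Definition _ w := Content_SigmaSubAdditive_isMeasure.Build _ R
  (cylinders_of Z) (cylinder_content w) (cylinder_content_sigma_subadditive w).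

End prefix_law.

(* The law on trajectories of the Markov chain with transition kernel K started
   at z. By chain_lawE it is the Caratheodory extension of its finite-horizon
   laws; the coordinates >= 1 of the initial trajectory [cst z] are redrawn. *)
Section chain_law.
Context d (Z : measurableType d) (R : realType).
Variables (K : R.-pker Z ~> Z) (z : Z).

Definition chain_law (A : set (trajectories Z)) : \bar R :=
  measure_extension (cylinder_content K (cst z)) A.

Let chain_law0 : chain_law set0 = 0.
Proof. exact: measure0. Qed.

Let chain_law_ge0 A : 0 <= chain_law A.
Proof. exact: measure_ge0. Qed.

Let chain_law_sigma_additive : semi_sigma_additive chain_law.
Proof.
move=> F mF tF mUF; apply: (@measure_semi_sigma_additive _ _ _
  (measure_extension (cylinder_content K (cst z))) F) => //.
- by move=> i; rewrite /measurable/= sigma_cylinders; exact: mF.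
- by rewrite /measurable/= sigma_cylinders.
Qed.

HB.instance Definition _ :=
  isMeasure.Build _ (trajectories Z) R chain_law
    chain_law0 chain_law_ge0 chain_law_sigma_additive.

Lemma chain_lawE n A : measurable A -> prefix_dependent n A ->
  chain_law A = prefix_law K 0 n (cst z) A.
Proof.
move=> mA pA; rewrite /chain_law /measure_extension measurable_mu_extE//=.
- exact: cylinder_contentE.
- by split => //; exists n.
Qed.

Let chain_law_setT : chain_law setT = 1.
Proof.
rewrite (@chain_lawE 0 setT)//.
exact: (prob_kernel (s := prefix_law K 0 0)).
Qed.

HB.instance Definition _ :=
  Measure_isProbability.Build _ _ _ chain_law chain_law_setT.

End chain_law.

(* The disjoint union of T and {None}; the fictitious state s^+ is
   [None : option S] and the fictitious action a^+ is [None : option A]. *)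
Definition option_display : measure_display -> measure_display.
Proof. by []. Qed.

Section option_measurable.
Context d (T : measurableType d).

Definition option_measurable : set (set (option T)) :=
  [set A | measurable (Some @^-1` A)].

Let option_measurable0 : option_measurable set0.
Proof. by rewrite /option_measurable/= preimage_set0. Qed.

Let option_measurableC A : option_measurable A -> option_measurable (~` A).
Proof. by rewrite /option_measurable/= preimage_setC; exact: measurableC. Qed.

Let option_measurable_bigcup (F : (set (option T))^nat) :
  (forall i, option_measurable (F i)) -> option_measurable (\bigcup_i F i).
Proof.
move=> mF; rewrite /option_measurable/= preimage_bigcup.
exact: bigcupT_measurable.
Qed.

HB.instance Definition _ := isMeasurable.Build (option_display d) (option T)
  option_measurable0 option_measurableC option_measurable_bigcup.

Lemma measurable_Some : measurable_fun [set: T] Some.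
Proof. by move=> _ A mA; rewrite setTI. Qed.

Lemma measurable_None : measurable [set (None : option T)].
Proof.
suff : measurable (Some @^-1` [set (None : option T)]) by [].
by rewrite (_ : _ @^-1` _ = set0)//; apply/seteqP; split.
Qed.

Lemma measurable_image_Some (A : set T) :
  measurable A -> measurable (Some @` A).
Proof.
move=> mA; suff : measurable (Some @^-1` (Some @` A)) by [].
rewrite (_ : _ @^-1` _ = A)//; apply/seteqP; split => [x [y Ay [<-]]//|x Ax].
by exists x.
Qed.

End option_measurable.

Section option_product.
Context d d' d'' (S : measurableType d) (T : measurableType d')
  (Y : measurableType d'').

Let i (st : S * T) : option S * T := (Some st.1, st.2).

Let measurable_image_i (B : set (S * T)) : measurable B -> measurable (i @` B).
Proof.
have iT : measurable (i @` setT).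
  rewrite (_ : i @` setT = (Some @` [set: S]) `*` [set: T]).
    by apply: measurableX => //; exact: measurable_image_Some.
  apply/seteqP; split; first by move=> _ [[s t] _ <-]; split => //; exists s.
  by move=> [x t] /= [[s _ <-] _]; exists (s, t).
rewrite measurable_prod_measurableType; move: B; apply: smallest_sub.
  split.
  - by rewrite /= image_set0.
  - move=> A /= mA; rewrite (_ : i @` _ = i @` setT `\` i @` A).
      exact: measurableD.
    apply/seteqP; split => [_ [[s t] [_ nA] <-]|_ [[[s t] _ <-] nA]].
      split; first by exists (s, t).
      by move=> [[s' t'] A' [ss' tt']]; apply: nA; rewrite -ss' -tt'.
    by exists (s, t) => //; split => // Ast; apply: nA; exists (s, t).
  - by move=> F mF /=; rewrite image_bigcup; exact: bigcupT_measurable.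
move=> _ [A mA [B mB <-]]; rewrite /=.
rewrite (_ : i @` _ = (Some @` A) `*` B).
  by apply: measurableX => //; exact: measurable_image_Some.
apply/seteqP; split.
  by move=> _ [[s t] [As Bt] <-]; split => //; exists s.
by move=> [x t] /= [[s As <-] Bt]; exists (s, t).
Qed.

Lemma measurable_fun_optionX (f : option S * T -> Y) :
  measurable_fun [set: S * T] (fun st => f (Some st.1, st.2)) ->
  measurable_fun [set: T] (fun t => f (None, t)) ->
  measurable_fun [set: option S * T] f.
Proof.
move=> mfS mfN _ B mB; rewrite setTI.
rewrite (_ : f @^-1` B = i @` ((fun st => f (Some st.1, st.2)) @^-1` B) `|`
    [set None] `*` ((fun t => f (None, t)) @^-1` B)).
  apply: measurableU.
    by apply: measurable_image_i; rewrite -[X in measurable X]setTI; exact: mfS.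
  apply: measurableX; first exact: measurable_None.
  by rewrite -[X in measurable X]setTI; exact: mfN.
apply/seteqP; split => [[[s|] t] fB|[x t]].
- by left; exists (s, t).
- by right.
- by case=> [[[s t'] fB [<- <-]]|[/= -> ]].
Qed.

End option_product.

Lemma measurable_fun_kernel_preimage d d' d'' (X : measurableType d)
    (Y : measurableType d') (Z : measurableType d'') (R : realType)
    (k : R.-pker X ~> Y) (g : X * Y -> Z) (U : set Z) :
  measurable_fun setT g -> measurable U ->
  measurable_fun [set: X] (fun x => k x [set y | U (g (x, y))]).
Proof.
move=> mg mU; have mgU : measurable (g @^-1` U).
  by rewrite -[X in measurable X]setTI; exact: mg.
have := measurable_fun_xsection_finite_kernel k (mem_set mgU).
apply: eq_measurable_fun => x _ /=; congr (k x _).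
by apply/seteqP; split => y; rewrite /xsection/= inE.
Qed.

Section mdp.
Context d d' (X : measurableType d) (A : measurableType d') (R : realType).
Variables (P : R.-pker (X * A) ~> X) (r : X * A -> R) (gamma : R).
Variable pi : R.-pker X ~> A.

Lemma state_action_prob xa :
  mkproduct P (kprecomp pi measurable_snd) xa [set: X * A] = 1.
Proof.
rewrite /= /kproduct /kernel.intker_indic (eq_integral (cst 1)).
  by rewrite integral_cst// prob_kernel mule1.
move=> y _; rewrite (eq_integral (cst 1)) => [|z _]; last by rewrite indicT.
by rewrite integral_cst// prob_kernel mule1.
Qed.

(* (x, a) |-> P(dx' | x, a) pi(da' | x'), the transition kernel of the chain of
   state-action pairs under the policy pi. *)
Definition state_action_kernel : R.-pker (X * A) ~> (X * A)%type :=
  pker_of (measurable_kernel (mkproduct P (kprecomp pi measurable_snd)))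
    state_action_prob.

Definition action_value (x : X) (a : A) : \bar R :=
  \int[chain_law state_action_kernel (x, a)]_w
    \sum_(0 <= t <oo) (gamma ^+ t * r (w t))%:E.

Definition state_value (x : X) : \bar R := \int[pi x]_a action_value x a.

End mdp.

Section state_space.
Context dS dC (S : measurableType dS) (C : measurableType dC).

Definition real_state (x : S * C) : option S * C := (Some x.1, x.2).

Lemma measurable_real_state : measurable_fun [set: S * C] real_state.
Proof.
apply: measurable_fun_pair; last exact: measurable_snd.
exact: (measurableT_comp (@measurable_Some _ S) measurable_fst).
Qed.

Variable G : C -> set S.

Definition goal_set : set (S * C) := [set x | G x.2 x.1].

Lemma measurable_in_goal : measurable goal_set ->
  measurable_fun [set: S * C] (fun x => `[< G x.2 x.1 >]).
Proof.
move=> mG; apply: (@measurable_fun_bool _ _ _ _ true); rewrite setTI.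
rewrite (_ : _ @^-1` _ = goal_set)//.
by apply/seteqP; split => x /=; [move/asboolP|move=> ?; apply/asboolP].
Qed.
End state_space.

Section contextual_mdp.
Context dS dA dC (S : measurableType dS) (A : measurableType dA)
  (C : measurableType dC) (R : realType).
Variables (P : R.-pker (S * A) ~> S) (G : C -> set S).

Hypothesis mG : measurable (goal_set G).

Lemma measurable_enter (c : C) :
  measurable_fun [set: S] (fun s => (Some s, c)).
Proof. by apply: measurable_fun_pair => //; exact: measurable_Some. Qed.

Definition move_to (c : C) (m : {measure set S -> \bar R}) :
    {measure set (option S * C) -> \bar R} :=
  push (measurable_enter c) m.

Definition absorb (c : C) : {measure set (option S * C) -> \bar R} :=
  \d_(None, c).

Definition original_step (z : option S * C * A) :
    {measure set (option S * C) -> \bar R} :=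
  let: (o, c, a) := z in
  if o is Some s then
    if `[< G c s >] then absorb c else move_to c (P (s, a))
  else absorb c.

Definition augmented_step (z : option S * C * option A) :
    {measure set (option S * C) -> \bar R} :=
  match z with
  | (Some s, c, Some a) => move_to c (P (s, a))
  | (_, c, _) => absorb c
  end.

Lemma measurable_absorb U : measurable U ->
  measurable_fun [set: C] (absorb ^~ U).
Proof.
move=> mU.
exact: (measurable_kernel (kdirac (pair1_measurable (None : option S))) U mU).
Qed.

Lemma measurable_move_to U : measurable U ->
  measurable_fun [set: S * A * C] (fun x => move_to x.2 (P x.1) U).
Proof.
move=> mU.
pose k := kprecomp P (@measurable_fst _ _ (S * A)%type C).
apply: (@measurable_fun_kernel_preimage _ _ _ _ _ _ _ k
  (fun y => (Some y.2, y.1.2)) U _ mU).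
apply: measurable_fun_pair.
  exact: (measurableT_comp (@measurable_Some _ S) measurable_snd).
exact: (measurableT_comp measurable_snd measurable_fst).
Qed.

Lemma absorb_prob c : absorb c setT = 1.
Proof. exact: diracT. Qed.

Lemma measurable_original_step U : measurable U ->
  measurable_fun [set: option S * C * A] (original_step ^~ U).
Proof.
move=> mU.
pose g (y : option S * (C * A)) := original_step (y.1, y.2.1, y.2.2) U.
suff mg : measurable_fun setT g.
  rewrite (_ : original_step ^~ U = g \o fun z => (z.1.1, (z.1.2, z.2))).
    apply: measurableT_comp mg _.
    apply: measurable_fun_pair.
      exact: (measurableT_comp measurable_fst measurable_fst).
    apply: measurable_fun_pair => //.
    exact: (measurableT_comp measurable_snd measurable_fst).
  by apply/funext => -[[x c] a].
apply: measurable_fun_optionX; last first.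
  exact: (measurableT_comp (measurable_absorb mU) measurable_fst).
rewrite /g /original_step /=.
rewrite [X in measurable_fun _ X](_ : _ = fun y : S * (C * A) =>
    if `[< G y.2.1 y.1 >] then absorb y.2.1 U
    else move_to y.2.1 (P (y.1, y.2.2)) U); last first.
  by apply/funext => y; case: ifP.
apply: measurable_fun_ifT.
- apply: (measurableT_comp (measurable_in_goal mG)
    (_ : measurable_fun setT (fun y : S * (C * A) => (y.1, y.2.1)))).
  apply: measurable_fun_pair => //.
  exact: (measurableT_comp measurable_fst measurable_snd).
- apply: (measurableT_comp (measurable_absorb mU)).
  exact: (measurableT_comp measurable_fst measurable_snd).
- apply: (measurableT_comp (measurable_move_to mU)
    (_ : measurable_fun setT (fun y : S * (C * A) => (y.1, y.2.2, y.2.1)))).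
  apply: measurable_fun_pair; last first.
    exact: (measurableT_comp measurable_fst measurable_snd).
  apply: measurable_fun_pair => //.
  exact: (measurableT_comp measurable_snd measurable_snd).
Qed.

Lemma original_step_prob z : original_step z setT = 1.
Proof.
case: z => -[[s|] c] a /=; last exact: absorb_prob.
by case: ifP => _; [exact: absorb_prob|apply: push_prob; exact: prob_kernel].
Qed.

Lemma measurable_augmented_step U : measurable U ->
  measurable_fun [set: option S * C * option A] (augmented_step ^~ U).
Proof.
move=> mU.
pose g (y : option S * (C * option A)) := augmented_step (y.1, y.2.1, y.2.2) U.
suff mg : measurable_fun setT g.
  rewrite (_ : augmented_step ^~ U = g \o fun z => (z.1.1, (z.1.2, z.2))).
    apply: measurableT_comp mg _.
    apply: measurable_fun_pair.
      exact: (measurableT_comp measurable_fst measurable_fst).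
    apply: measurable_fun_pair => //.
    exact: (measurableT_comp measurable_snd measurable_fst).
  by apply/funext => -[[x c] a].
apply: measurable_fun_optionX; last first.
  exact: (measurableT_comp (measurable_absorb mU) measurable_fst).
pose h (y : option A * (S * C)) := augmented_step (Some y.2.1, y.2.2, y.1) U.
suff mh : measurable_fun setT h.
  rewrite [X in measurable_fun _ X](_ : _ =
      h \o fun z => (z.2.2, (z.1, z.2.1))).
    apply: measurableT_comp mh _.
    apply: measurable_fun_pair.
      exact: (measurableT_comp measurable_snd measurable_snd).
    apply: measurable_fun_pair => //.
    exact: (measurableT_comp measurable_fst measurable_snd).
  by apply/funext => -[s [c a]].
apply: measurable_fun_optionX; last first.
  exact: (measurableT_comp (measurable_absorb mU) measurable_snd).
apply: (measurableT_comp (measurable_move_to mU)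
  (_ : measurable_fun setT (fun y : A * (S * C) => (y.2.1, y.1, y.2.2)))).
apply: measurable_fun_pair; last first.
  exact: (measurableT_comp measurable_snd measurable_snd).
apply: measurable_fun_pair => //.
exact: (measurableT_comp measurable_fst measurable_snd).
Qed.

Lemma augmented_step_prob z : augmented_step z setT = 1.
Proof.
case: z => -[[s|] c] [a|] /=; try exact: absorb_prob.
by apply: push_prob; exact: prob_kernel.
Qed.

Definition original_transition :
    R.-pker (option S * C * A) ~> (option S * C)%type :=
  pker_of measurable_original_step original_step_prob.

Definition augmented_transition :
    R.-pker (option S * C * option A) ~> (option S * C)%type :=
  pker_of measurable_augmented_step augmented_step_prob.

Definition original_reward (z : option S * C * A) : R :=
  if z.1 is (Some s, c) then \1_(G c) s else 0.

Definition augmented_reward (z : option S * C * option A) : R :=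
  if z is (Some s, c, None) then \1_(G c) s else 0.

End contextual_mdp.
Arguments original_reward {dS dA dC S A C R} G z.
Arguments augmented_reward {dS dA dC S A C R} G z.

Section policies.
Context dS dA dC (S : measurableType dS) (A : measurableType dA)
  (C : measurableType dC) (R : realType).

(* A policy pi on X = S * C completed by an arbitrary choice eta on the states
   (s^+, c), where the action is irrelevant. *)
Section with_absorbing.
Context dB (B : measurableType dB).
Variables (pi : R.-pker (S * C) ~> B) (eta : R.-pker C ~> B).

Definition completed_choice (x : option S * C) : {measure set B -> \bar R} :=
  if x.1 is Some s then pi (s, x.2) else eta x.2.

Lemma measurable_completed_choice U : measurable U ->
  measurable_fun [set: option S * C] (completed_choice ^~ U).
Proof.
move=> mU; apply: measurable_fun_optionX; last exact: measurable_kernel.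
rewrite [X in measurable_fun _ X](_ : _ = pi ^~ U).
  exact: measurable_kernel.
by apply/funext => -[].
Qed.

Lemma completed_choice_prob x : completed_choice x setT = 1.
Proof. by case: x => -[s|] c; exact: prob_kernel. Qed.

Definition with_absorbing : R.-pker (option S * C) ~> B :=
  pker_of measurable_completed_choice completed_choice_prob.
End with_absorbing.

Section extend_policy.
Variables (G : C -> set S) (mG : measurable (goal_set G)).
Variable pi : R.-pker (S * C) ~> A.

Definition extended_choice (x : S * C) : {measure set (option A) -> \bar R} :=
  if `[< G x.2 x.1 >] then (\d_None : {measure set (option A) -> \bar R})
  else push (@measurable_Some _ A) (pi x).

Lemma measurable_extended_choice U : measurable U ->
  measurable_fun [set: S * C] (extended_choice ^~ U).
Proof.
move=> mU; rewrite [X in measurable_fun _ X](_ : _ = fun x : S * C =>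
    if `[< G x.2 x.1 >] then \d_(None : option A) U else pi x (Some @^-1` U)).
  apply: measurable_fun_ifT => //; first exact: measurable_in_goal.
  exact: measurable_kernel.
by apply/funext => x; rewrite /extended_choice; case: ifP.
Qed.

Lemma extended_choice_prob x : extended_choice x setT = 1.
Proof.
rewrite /extended_choice; case: ifP => _; first exact: diracT.
by apply: push_prob; exact: prob_kernel.
Qed.

Definition extend_policy : R.-pker (S * C) ~> option A :=
  pker_of measurable_extended_choice extended_choice_prob.
End extend_policy.

(* An action of A is kept, and a^+ is redrawn from u. *)
Section restrict_policy.
Variable u : probability A R.

Definition redraw (o : option A) : {measure set A -> \bar R} :=
  if o is Some a then \d_a else u.

Lemma measurable_redraw U : measurable U ->
  measurable_fun [set: option A] (redraw ^~ U).
Proof.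
move=> mU _ B mB; rewrite setTI.
suff : measurable ((fun a => \d_a U : \bar R) @^-1` B) by [].
rewrite -[X in measurable X]setTI.
exact: (measurable_kernel (kdirac (@measurable_id _ A setT)) U mU).
Qed.

Lemma redraw_prob o : redraw o setT = 1.
Proof. by case: o => [a|]; [exact: diracT|exact: probability_setT]. Qed.

Definition redraw_kernel : R.-pker (option A) ~> A :=
  pker_of measurable_redraw redraw_prob.

Variable xi : R.-pker (option S * C) ~> option A.

Definition restrict_policy : R.-pker (S * C) ~> A :=
  pkcomp (kprecomp xi (@measurable_real_state _ _ S C))
         (kprecomp redraw_kernel measurable_snd).

Lemma restrict_policyE (x : S * C) (U : set A) : measurable U ->
  restrict_policy x U =
    xi (real_state x) (Some @` U) + xi (real_state x) [set None] * u U.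
Proof.
move=> mU; rewrite /restrict_policy/= /kcomp/=.
rewrite (_ : pker_of _ _ _ = xi (real_state x))//.
rewrite (eq_integral (fun o : option A =>
    (\1_(Some @` U) o)%:E + u U * (\1_[set None] o)%:E)).
  rewrite ge0_integralD//=.
  - rewrite integral_indic ?setIT//; last exact: measurable_image_Some.
    rewrite ge0_integralZl//=.
      by rewrite integral_indic ?setIT 1?muleC//; exact: measurable_None.
    by apply/measurable_EFinP; apply: measurable_indic; exact: measurable_None.
  - apply/measurable_EFinP; apply: measurable_indic.
    exact: measurable_image_Some.
  - by move=> o _; apply: mule_ge0 => //; rewrite lee_fin.
  - apply: measurable_funeM; apply/measurable_EFinP; apply: measurable_indic.
    exact: measurable_None.
move=> [a|] _ /=; rewrite /pker_of/= !indicE.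
  rewrite [X in _ + _ * X](_ : _ = 0) ?mule0 ?adde0.
    rewrite diracE; congr (_%:R%:E); congr nat_of_bool.
    apply/idP/idP; rewrite !inE; first by exists a.
    by move=> [b Ub [<-]].
  by rewrite memNset.
rewrite (memNset (_ : ~ (Some @` U) None)) ?add0e; last by case.
by rewrite mem_set ?mule1.
Qed.

End restrict_policy.
End policies.

(* Uniform distribution with respect to a reference measure mu (the counting
   measure when A is finite). The Dirac measure is only the default value of
   mnormalize when the mass of mu is 0 or infinite. *)
Definition uniform_law d (A : measurableType d) (R : realType)
    (mu : {measure set A -> \bar R}) : probability A R :=
  mnormalize mu (\d_(point : A)).

Section values.
Context dS dA dC (S : measurableType dS) (A : measurableType dA)
  (C : measurableType dC) (R : realType).
Variables (P : R.-pker (S * A) ~> S) (G : C -> set S).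
Variable gamma : R.

Section original.
Hypothesis mG : measurable (goal_set G).
Variable pi : R.-pker (option S * C) ~> A.

Definition original_Q : option S * C -> A -> \bar R :=
  action_value (original_transition P mG) (original_reward G) gamma pi.

Definition original_V : option S * C -> \bar R :=
  state_value (original_transition P mG) (original_reward G) gamma pi.
End original.

Section augmented.
Variable pi : R.-pker (option S * C) ~> option A.

Definition augmented_Q : option S * C -> option A -> \bar R :=
  action_value (augmented_transition C P) (augmented_reward G) gamma pi.

Definition augmented_V : option S * C -> \bar R :=
  state_value (augmented_transition C P) (augmented_reward G) gamma pi.
End augmented.
End values.

(* Main.v *)
(* The values of both MDPs are limits of their n-step truncations, by monotone
   convergence, and these satisfy the Bellman recursion. By induction on n, the
   n-step values compare at every state (s, c). On the goal set the original
   value is 1 from step 1 on, which bounds every augmented value. Off the goal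
   set the two MDPs move alike under the actions of A, while a^+ yields 0 in the
   augmented MDP, so that redistributing its mass over A cannot decrease the
   value. *)

Require Import Defs.
From HB Require Import structures.
From mathcomp Require Import all_boot all_order all_algebra.
From mathcomp Require Import all_classical all_reals all_analysis.
From mathcomp Require Import measurable_realfun.

Set Implicit Arguments.
Unset Strict Implicit.
Unset Printing Implicit Defensive.
Import Order.TTheory GRing.Theory Num.Theory.
Import numFieldNormedType.Exports.

Local Open Scope classical_set_scope.
Local Open Scope ring_scope.
Local Open Scope ereal_scope.

(** * Change of variables and expectations along a Markov chain *)

Lemma ge0_integral_push d d' (X : measurableType d) (Y : measurableType d')
    (R : realType) (f : X -> Y) (mf : measurable_fun [set: X] f)
    (m : {measure set X -> \bar R}) (g : Y -> \bar R) :
  (forall y, 0 <= g y) -> measurable_fun [set: Y] g ->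
  \int[push mf m]_y g y = \int[m]_x g (f x).
Proof.
move=> g0 mg.
by rewrite -(@ge0_integral_pushforward _ _ _ _ _ _ mf m setT) ?preimage_setT.
Qed.

Section expectation.
Context d (Z : measurableType d) (R : realType) (K : R.-pker Z ~> Z).

(** The [t]-th iterate of the Markov operator of [K] on [g]: the mean of [g] at time [t] for the
    chain started at [z]. *)
Fixpoint expectation (t : nat) (g : Z -> \bar R) (z : Z) : \bar R :=
  if t is t'.+1 then \int[K z]_y expectation t' g y else g z.

Lemma expectation_ge0 t g : (forall z, 0 <= g z) ->
  forall z, 0 <= expectation t g z.
Proof. by move=> g0; elim: t => //= t ih z; exact: integral_ge0. Qed.

Lemma measurable_expectation t g : (forall z, 0 <= g z) ->
  measurable_fun [set: Z] g -> measurable_fun [set: Z] (expectation t g).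
Proof.
move=> g0 mg; elim: t => //= t ih; apply: measurable_fun_integral_kernel => //.
  by move=> U mU; exact: measurable_kernel.
exact: expectation_ge0.
Qed.

(** Induction on [n] with [k] and [w] general: once coordinate [k.+1] is drawn, the remaining [n]
    draws form a prefix law started at [k.+1], whose value there is the point just drawn. *)
Lemma integral_prefix_law g k n w : (forall z, 0 <= g z) ->
  measurable_fun [set: Z] g ->
  \int[prefix_law K k n w]_u g (u (k + n)%N) = expectation n g (w k).
Proof.
move=> g0 mg.
have mgn i : measurable_fun setT (fun u : trajectories Z => g (u i)).
  exact: (measurableT_comp mg (measurable_coordinate i)).
elim: n k w => [|n ih] k w.
  rewrite addn0 [LHS](_ : _ = \int[\d_w]_u g (u k))//.
  by rewrite integral_dirac// diracT mul1e.
transitivity (\int[K (w k)]_z \int[prefix_law K k.+1 n (update k.+1 (w, z))]_u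
    g (u (k + n.+1)%N)).
  exact: (integral_kcomp (kprecomp K (measurable_coordinate k))
    (kprecomp (prefix_law K k.+1 n) (@measurable_update _ Z k.+1)) w).
apply: eq_integral => z _; rewrite -addSnnS ih.
by rewrite /update eqxx.
Qed.

(** An event about coordinate [t] is a cylinder, on which the extended measure agrees with the law
    of the first [t] draws, so the two image laws under coordinate [t] coincide. *)
Lemma integral_chain_law g t z : (forall z, 0 <= g z) ->
  measurable_fun [set: Z] g ->
  \int[chain_law K z]_w g (w t) = expectation t g z.
Proof.
move=> g0 mg.
rewrite -[RHS](@integral_prefix_law g 0 t (cst z))// add0n.
rewrite -!(ge0_integral_push (@measurable_coordinate _ Z t))//.
apply: eq_measure_integral => B mB _; apply: chain_lawE.
  by apply: sub_sigma_algebra; exists t, B.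
by move=> w w' ww' /=; rewrite /preimage/= ww'.
Qed.

(** * Truncated discounted sums *)

Section discounted.
Variables (r : Z -> R) (gamma : R).
Hypotheses (r_ge0 : forall z, (0 <= r z)%R) (mr : measurable_fun [set: Z] r).
Hypothesis gamma_ge0 : (0 <= gamma)%R.

(** The expected discounted sum of the first [n] rewards, in Bellman form, so that later inductions
    on the horizon can unfold one transition. *)
Fixpoint horizon_value (n : nat) (z : Z) : \bar R :=
  if n is n'.+1 then (r z)%:E + gamma%:E * \int[K z]_y horizon_value n' y
  else 0.

Let e t := expectation t (EFin \o r).

Let e_ge0 t z : 0 <= e t z.
Proof. by apply: expectation_ge0 => y; rewrite lee_fin. Qed.

Let me t : measurable_fun [set: Z] (e t).
Proof.
apply: measurable_expectation; first by move=> y; rewrite lee_fin.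
exact/measurable_EFinP.
Qed.

Let ge_e_ge0 t z : 0 <= (gamma ^+ t)%:E * e t z.
Proof. by rewrite mule_ge0// lee_fin exprn_ge0. Qed.

(** Each unfolding of the recursion shifts time by one and contributes a factor [gamma]. As a sum of
    nonnegative terms, the truncation is visibly nonnegative, measurable and nondecreasing in
    [n]. *)
Lemma horizon_valueE n z :
  horizon_value n z = \sum_(0 <= t < n) (gamma ^+ t)%:E * e t z.
Proof.
elim: n z => [|n ih] z /=; first by rewrite big_geq.
rewrite big_nat_recl// expr0 mul1e; congr (_ + _).
under eq_integral do rewrite ih.
rewrite ge0_integral_sum//; last by move=> t; exact: measurable_funeM.
rewrite ge0_sume_distrr; last by move=> t _; exact: integral_ge0.
apply: eq_bigr => t _.
by rewrite ge0_integralZl// ?lee_fin ?exprn_ge0// muleA -EFinM -exprS.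
Qed.

Lemma horizon_value_ge0 n z : 0 <= horizon_value n z.
Proof. by rewrite horizon_valueE sume_ge0. Qed.

Lemma measurable_horizon_value n : measurable_fun [set: Z] (horizon_value n).
Proof.
rewrite (_ : horizon_value n =
    fun z => \sum_(0 <= t < n) (gamma ^+ t)%:E * e t z); last first.
  by apply/funext => z; exact: horizon_valueE.
by apply: emeasurable_sum => t; exact: measurable_funeM.
Qed.

Lemma horizon_value_nd z :
  {homo horizon_value ^~ z : n m / (n <= m)%N >-> n <= m}.
Proof.
by move=> n m nm; rewrite !horizon_valueE lee_sum_nneg_natr.
Qed.

(** The terms are nonnegative, so series and integral can be exchanged; the partial sums of the
    resulting series are the truncated values. *)
Lemma integral_discounted_sum z :
  \int[chain_law K z]_w (\sum_(0 <= t <oo) (gamma ^+ t * r (w t))%:E) =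
  limn (horizon_value ^~ z).
Proof.
rewrite integral_nneseries//.
- rewrite (_ : horizon_value ^~ z =
    fun n => \sum_(0 <= t < n) (gamma ^+ t)%:E * e t z); last first.
    by apply/funext => n; exact: horizon_valueE.
  apply: eq_eseriesr => t _.
  under eq_integral do rewrite EFinM.
  rewrite ge0_integralZl//.
  + congr (_ * _); apply: (@integral_chain_law (EFin \o r)).
      by move=> y; rewrite /= lee_fin.
    exact/measurable_EFinP.
  + apply/measurable_EFinP.
    exact: (measurableT_comp mr (measurable_coordinate t)).
  + by move=> w _; rewrite lee_fin.
  + by rewrite lee_fin exprn_ge0.
- move=> t; apply/measurable_EFinP; apply: measurable_funM => //.
  exact: (measurableT_comp mr (measurable_coordinate t)).
- by move=> t w _; rewrite lee_fin mulr_ge0// exprn_ge0.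
Qed.

End discounted.
End expectation.

(** * Bellman recursion and monotone limits for a general decision process *)

Section markov_decision_process.
Context d d' (X : measurableType d) (A : measurableType d') (R : realType).
Variables (P : R.-pker (X * A) ~> X) (r : X * A -> R) (gamma : R).
Variable pi : R.-pker X ~> A.
Hypotheses (r_ge0 : forall z, (0 <= r z)%R).
Hypothesis (mr : measurable_fun [set: X * A] r).
Hypothesis gamma_ge0 : (0 <= gamma)%R.

Definition horizon_Q n xa :=
  horizon_value (state_action_kernel P pi) r gamma n xa.

Definition horizon_V n x := \int[pi x]_a horizon_Q n (x, a).

Lemma horizon_Q_ge0 n xa : 0 <= horizon_Q n xa.
Proof. exact: horizon_value_ge0. Qed.

Lemma horizon_V_ge0 n x : 0 <= horizon_V n x.
Proof. by apply: integral_ge0 => a _; exact: horizon_Q_ge0. Qed.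

Lemma measurable_horizon_Q n : measurable_fun [set: X * A] (horizon_Q n).
Proof. exact: measurable_horizon_value. Qed.

Lemma measurable_horizon_Q2 n x :
  measurable_fun [set: A] (fun a => horizon_Q n (x, a)).
Proof. exact: measurable_fun_pair2 (measurable_horizon_Q n). Qed.

Lemma measurable_horizon_V n : measurable_fun [set: X] (horizon_V n).
Proof.
apply: measurable_fun_integral_finite_kernel; first exact: horizon_Q_ge0.
exact: measurable_horizon_Q.
Qed.

(** The product kernel agrees on measurable sets with the composition of [P] and a kernel that keeps
    the new state and draws an action there; integration against a composition is iterated
    integration. *)
Lemma integral_state_action_kernel xa f : (forall z, 0 <= f z) ->
  measurable_fun [set: X * A] f ->
  \int[state_action_kernel P pi xa]_z f z =
  \int[P xa]_y \int[pi y]_a f (y, a).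
Proof.
move=> f0 mf.
(* k (x, a, y) is the law of (y, b) with b drawn from pi y. *)
pose k (z : X * A * X) := push (@pair1_measurable _ _ X A z.2) (pi z.2).
have mk U : measurable U -> measurable_fun [set: X * A * X] (k ^~ U).
  move=> mU; apply: (@measurable_fun_kernel_preimage _ _ _ _ _ _ _
    (kprecomp pi measurable_snd) (fun zy => (zy.1.2, zy.2)) U _ mU).
  apply: measurable_fun_pair => //.
  exact: (measurableT_comp measurable_snd measurable_fst).
have k1 z : k z setT = 1 by apply: push_prob; exact: prob_kernel.
transitivity (\int[kcomp P (pker_of mk k1) xa]_z f z).
  apply: eq_measure_integral => B mB _.
  apply: eq_integral => y _ /=.
  rewrite [LHS](_ : _ = \int[pi y]_a (\1_(pair y @^-1` B) a)%:E)//.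
  rewrite integral_indic ?setIT// -[X in measurable X]setTI.
  exact: (pair1_measurable y).
rewrite integral_kcomp//; apply: eq_integral => y _.
exact: ge0_integral_push.
Qed.

Lemma horizon_QS n xa : horizon_Q n.+1 xa =
  (r xa)%:E + gamma%:E * \int[P xa]_y horizon_V n y.
Proof.
congr (_ + _ * _); apply: integral_state_action_kernel.
  exact: horizon_Q_ge0.
exact: measurable_horizon_Q.
Qed.

Lemma horizon_Q_nd xa : {homo horizon_Q ^~ xa : n m / (n <= m)%N >-> n <= m}.
Proof. exact: horizon_value_nd. Qed.

Lemma horizon_V_nd x : {homo horizon_V ^~ x : n m / (n <= m)%N >-> n <= m}.
Proof.
move=> n m nm; apply: ge0_le_integral => //.
- by move=> a _; exact: horizon_Q_ge0.
- exact: measurable_horizon_Q2.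
- exact: measurable_horizon_Q2.
- by move=> a _; exact: horizon_Q_nd.
Qed.

Lemma action_valueE x a : action_value P r gamma pi x a =
  limn (fun n => horizon_Q n (x, a)).
Proof. exact: integral_discounted_sum. Qed.

(** Monotone convergence moves the limit in the horizon out of the integral over the first
    action. *)
Lemma state_valueE x : state_value P r gamma pi x = limn (horizon_V ^~ x).
Proof.
rewrite /state_value; under eq_integral do rewrite action_valueE.
rewrite monotone_convergence//.
- by move=> n; exact: measurable_horizon_Q2.
- by move=> n a _; exact: horizon_Q_ge0.
- by move=> a _; exact: horizon_Q_nd.
Qed.

End markov_decision_process.

(** * Nonnegativity and measurability of the rewards *)

Section rewards.
Context dS dA dC (S : measurableType dS) (A : measurableType dA)
  (C : measurableType dC) (R : realType) (G : C -> set S).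

Lemma indic_goal (c : C) (s : S) :
  \1_(G c) s = \1_(goal_set G) (s, c) :> R.
Proof.
by rewrite !indicE; congr (_%:R)%R; apply/idP/idP; rewrite !inE.
Qed.

(** Reassociating the product makes [option S] its first factor, the form in which measurability is
    checked separately on [Some] and [None]. *)
Lemma measurable_fun_state_action d dB (B : measurableType dB)
    (Y : measurableType d) (f : option S * C * B -> Y) :
  measurable_fun [set: S * C * B] (fun z => f (real_state z.1, z.2)) ->
  measurable_fun [set: C * B] (fun z => f (None, z.1, z.2)) ->
  measurable_fun [set: option S * C * B] f.
Proof.
move=> mfS mfN.
pose g (y : option S * (C * B)) := f (y.1, y.2.1, y.2.2).
rewrite (_ : f = g \o fun z => (z.1.1, (z.1.2, z.2))); last first.
  by apply/funext => -[[x c] a].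
apply: measurableT_comp; last first.
  apply: measurable_fun_pair.
    exact: (measurableT_comp measurable_fst measurable_fst).
  apply: measurable_fun_pair => //.
  exact: (measurableT_comp measurable_snd measurable_fst).
apply: measurable_fun_optionX => //.
apply: (measurableT_comp mfS
  (_ : measurable_fun setT (fun y : S * (C * B) => (y.1, y.2.1, y.2.2)))).
apply: measurable_fun_pair; last first.
  exact: (measurableT_comp measurable_snd measurable_snd).
apply: measurable_fun_pair => //.
exact: (measurableT_comp measurable_fst measurable_snd).
Qed.

Lemma original_reward_ge0 z : (0 <= original_reward (A := A) (R := R) G z)%R.
Proof. by case: z => -[[s|] c] a; rewrite /original_reward. Qed.

Lemma augmented_reward_ge0 z : (0 <= augmented_reward (A := A) (R := R) G z)%R.
Proof. by case: z => -[[s|] c] [a|]; rewrite /augmented_reward. Qed.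

Hypothesis mG : measurable (goal_set G).

Lemma measurable_original_reward :
  measurable_fun setT (original_reward (A := A) (R := R) G).
Proof.
apply: measurable_fun_state_action => //.
apply: (eq_measurable_fun (fun z : S * C * A => \1_(goal_set G) z.1 : R)).
  by move=> [[s c] a] _; rewrite /original_reward/= indic_goal.
by apply: measurableT_comp => //; exact: measurable_indic.
Qed.

Lemma measurable_augmented_reward :
  measurable_fun setT (augmented_reward (A := A) (R := R) G).
Proof.
apply: measurable_fun_state_action => //.
(* On real states the augmented reward is a product of two indicators: being in the goal and playing
   [None]. *)
apply: (eq_measurable_fun (fun z : S * C * option A =>
    \1_(goal_set G) z.1 * \1_[set (None : option A)] z.2 : R)%R).
  move=> [[s c] [a|]] _ /=; last first.
    by rewrite indic_goal (indicE _ [set None]) mem_set// mulr1.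
  by rewrite (indicE _ [set None]) memNset// mulr0.
apply: measurable_funM.
  exact: (measurableT_comp (measurable_indic mG) measurable_fst).
exact: (measurableT_comp (measurable_indic (measurable_None A)) measurable_snd).
Qed.

End rewards.

(** * One-step recursions of the two processes *)

Section horizons.
Context dS dA dC (S : measurableType dS) (A : measurableType dA)
  (C : measurableType dC) (R : realType).
Variables (P : R.-pker (S * A) ~> S) (G : C -> set S).
Hypothesis mG : measurable (goal_set G).
Variable gamma : R.
Hypotheses (gamma_ge0 : (0 <= gamma)%R) (gamma_lt1 : (gamma < 1)%R).

Lemma integral_absorb c (f : option S * C -> \bar R) :
  measurable_fun setT f -> \int[absorb S R c]_y f y = f (None, c).
Proof. by move=> mf; rewrite integral_dirac// diracT mul1e. Qed.

Section original.
Variable pi : R.-pker (option S * C) ~> A.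

Local Notation Q :=
  (horizon_Q (original_transition P mG) (original_reward G) gamma pi).
Local Notation V :=
  (horizon_V (original_transition P mG) (original_reward G) gamma pi).

Let r0 := @original_reward_ge0 _ _ _ S A C R G.
Let mr := @measurable_original_reward _ _ _ S A C R G mG.

Let mV n : measurable_fun setT (V n).
Proof. exact: measurable_horizon_V. Qed.

Lemma original_horizon_QS n xa : Q n.+1 xa =
  (original_reward G xa)%:E +
  gamma%:E * \int[original_transition P mG xa]_y V n y.
Proof. exact: horizon_QS. Qed.

Lemma original_horizon_V_absorbed n c : V n (None, c) = 0.
Proof.
elim: n => [|n ih]; first by rewrite /horizon_V integral0.
rewrite /horizon_V integral0_eq// => a _; rewrite original_horizon_QS add0e.
by rewrite [X in _ * X](integral_absorb c (mV n)) ih mule0.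
Qed.

(** The reward 1 is collected at once, and the next state is absorbed and worth 0. The horizon is
    [n.+1] because the empty sum at horizon 0 is 0. *)
Lemma original_horizon_Q_goal n s c a : G c s -> Q n.+1 (Some s, c, a) = 1.
Proof.
move=> Gcs; rewrite original_horizon_QS.
rewrite /original_transition/= /pker_of/= /original_step ifT; last first.
  exact/asboolP.
rewrite (integral_absorb c (mV n)) original_horizon_V_absorbed mule0 adde0.
by rewrite /original_reward/= indicE mem_set.
Qed.

Lemma original_horizon_Q_move n s c a : ~ G c s ->
  Q n.+1 (Some s, c, a) = gamma%:E * \int[P (s, a)]_s' V n (Some s', c).
Proof.
move=> nGcs; rewrite original_horizon_QS.
rewrite /original_transition/= /pker_of/= /original_step ifF; last first.
  exact/asboolPn.
rewrite /original_reward/= indicE memNset// add0e; congr (_ * _).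
by apply: ge0_integral_push => // y; exact: horizon_V_ge0.
Qed.

End original.

Section augmented.
Variable pi : R.-pker (option S * C) ~> option A.

Local Notation Q :=
  (horizon_Q (augmented_transition C P) (augmented_reward G) gamma pi).
Local Notation V :=
  (horizon_V (augmented_transition C P) (augmented_reward G) gamma pi).

Let r0 := @augmented_reward_ge0 _ _ _ S A C R G.
Let mr := @measurable_augmented_reward _ _ _ S A C R G mG.

Let mV n : measurable_fun setT (V n).
Proof. exact: measurable_horizon_V. Qed.

Lemma augmented_horizon_QS n xa : Q n.+1 xa =
  (augmented_reward G xa)%:E +
  gamma%:E * \int[augmented_transition C P xa]_y V n y.
Proof. exact: horizon_QS. Qed.

Lemma augmented_horizon_V_absorbed n c : V n (None, c) = 0.
Proof.
elim: n => [|n ih]; first by rewrite /horizon_V integral0.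
rewrite /horizon_V integral0_eq// => a _; rewrite augmented_horizon_QS add0e.
by rewrite [X in _ * X](integral_absorb c (mV n)) ih mule0.
Qed.

Lemma augmented_horizon_Q_stop n s c :
  Q n.+1 (Some s, c, None) = (\1_(G c) s)%:E.
Proof.
rewrite augmented_horizon_QS [X in _ * X](integral_absorb c (mV n)).
by rewrite augmented_horizon_V_absorbed mule0 adde0.
Qed.

(** No case distinction on the goal: an action of [A] pays nothing and moves by [P] even inside
    it. *)
Lemma augmented_horizon_Q_move n s c a :
  Q n.+1 (Some s, c, Some a) = gamma%:E * \int[P (s, a)]_s' V n (Some s', c).
Proof.
rewrite augmented_horizon_QS add0e; congr (_ * _).
by apply: ge0_integral_push => // y; exact: horizon_V_ge0.
Qed.

(** Induction on the horizon: [None] pays at most 1 and ends the episode, while an action of [A]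
    pays 0 and multiplies by [gamma < 1] an average of values at most 1. *)
Lemma augmented_horizon_Q_le1 n s c a : Q n (Some s, c, a) <= 1.
Proof.
elim: n s a => [|n ih] s a; first exact: lee01.
case: a => [a|]; last first.
  by rewrite augmented_horizon_Q_stop lee_fin indicE lern1 leq_b1.
rewrite augmented_horizon_Q_move -(mule1 1); apply: lee_pmul => //.
- by apply: integral_ge0 => y _; exact: horizon_V_ge0.
- by rewrite lee_fin ltW.
(* The bound 1 is written as the integral of a constant against a probability, to compare integrands
   pointwise; the same is done below for the policy. *)
have -> : 1 = \int[P (s, a)]__ (1 : \bar R).
  by rewrite integral_cst// prob_kernel mule1.
apply: ge0_le_integral => //.
- by move=> s' _; exact: horizon_V_ge0.
- by apply: (measurableT_comp (mV n)); exact: measurable_enter.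
move=> s' _; rewrite /horizon_V.
have -> : 1 = \int[pi (Some s', c)]__ (1 : \bar R).
  by rewrite integral_cst// prob_kernel mule1.
apply: ge0_le_integral => //.
- by move=> b _; exact: horizon_Q_ge0.
- exact: measurable_horizon_Q2.
Qed.

End augmented.
End horizons.

(** * Comparison of the two processes *)

Section comparison.
Context dS dA dC (S : measurableType dS) (A : measurableType dA)
  (C : measurableType dC) (R : realType).
Variables (P : R.-pker (S * A) ~> S) (G : C -> set S).
Hypothesis mG : measurable (goal_set G).
Variable gamma : R.
Hypotheses (gamma_ge0 : (0 <= gamma)%R) (gamma_lt1 : (gamma < 1)%R).

Local Notation Q :=
  (horizon_Q (original_transition P mG) (original_reward G) gamma).
Local Notation V :=
  (horizon_V (original_transition P mG) (original_reward G) gamma).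
Local Notation Q_bar :=
  (horizon_Q (augmented_transition C P) (augmented_reward G) gamma).
Local Notation V_bar :=
  (horizon_V (augmented_transition C P) (augmented_reward G) gamma).

Let r_ge0 := @original_reward_ge0 _ _ _ S A C R G.
Let mr := @measurable_original_reward _ _ _ S A C R G mG.
Let r_bar_ge0 := @augmented_reward_ge0 _ _ _ S A C R G.
Let mr_bar := @measurable_augmented_reward _ _ _ S A C R G mG.

Section horizon_comparison.
Variables (pi : R.-pker (option S * C) ~> A)
  (pi_bar : R.-pker (option S * C) ~> option A).

(** In the goal the original value is 1, which bounds every augmented value. Elsewhere both sides
    average over the same law [P (s, a)], so the comparison of [V] at horizon [n] carries over to
    [Q] at [n.+1]. *)
Lemma le_horizon_Q n :
  (forall x, V_bar pi_bar n (real_state x) <= V pi n (real_state x)) ->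
  forall x a, Q_bar pi_bar n.+1 (real_state x, Some a) <=
              Q pi n.+1 (real_state x, a).
Proof.
move=> VV [s c] a; rewrite -[real_state _]/(Some s, c).
have [Gcs|nGcs] := pselect (G c s).
  by rewrite original_horizon_Q_goal//; exact: augmented_horizon_Q_le1.
rewrite augmented_horizon_Q_move// original_horizon_Q_move//.
apply: lee_wpmul2l; first by rewrite lee_fin.
apply: ge0_le_integral => //.
- by move=> s' _; exact: horizon_V_ge0.
- apply: (measurableT_comp
    (measurable_horizon_V _ _ r_bar_ge0 mr_bar _ n)) => //.
  exact: measurable_enter.
- apply: (measurableT_comp (measurable_horizon_V _ _ r_ge0 mr _ n)) => //.
  exact: measurable_enter.
- by move=> s' _; exact: (VV (s', c)).
Qed.

Lemma le_action_value :
  (forall n x, V_bar pi_bar n (real_state x) <= V pi n (real_state x)) ->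
  forall x a, augmented_Q P G gamma pi_bar (real_state x) (Some a) <=
              original_Q P gamma mG pi (real_state x) a.
Proof.
move=> VV x a; rewrite /augmented_Q /original_Q !action_valueE//.
apply: lee_lim; [exact/ereal_nondecreasing_is_cvgn/horizon_Q_nd|
  exact/ereal_nondecreasing_is_cvgn/horizon_Q_nd|].
(* At horizon 0 both truncations are 0; successors use the preceding lemma. *)
by apply: nearW => -[//|n]; exact: le_horizon_Q.
Qed.

Lemma le_state_value x :
  (forall n, V_bar pi_bar n (real_state x) <= V pi n (real_state x)) ->
  augmented_V P G gamma pi_bar (real_state x) <=
  original_V P gamma mG pi (real_state x).
Proof.
move=> VV; rewrite /augmented_V /original_V !state_valueE//.
apply: lee_lim; [exact/ereal_nondecreasing_is_cvgn/horizon_V_nd|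
  exact/ereal_nondecreasing_is_cvgn/horizon_V_nd|].
exact: nearW.
Qed.

End horizon_comparison.

(** Induction on the horizon. In the goal, stopping earns 1, as does every action of the original
    process; elsewhere both policies draw the same action and both processes make the same move. *)
Lemma extend_policy_horizon_V (pi : R.-pker (S * C) ~> A)
    (eta : R.-pker C ~> A) (eta_bar : R.-pker C ~> option A) n x :
  V_bar (with_absorbing (extend_policy mG pi) eta_bar) n (real_state x) =
  V (with_absorbing pi eta) n (real_state x).
Proof.
elim: n x => [|n ih] [s c]; first by rewrite /horizon_V !integral0.
set pi_bar := with_absorbing _ _ in ih *.
have mQ : measurable_fun setT (fun a => Q_bar pi_bar n.+1 (Some s, c, a)).
  exact: measurable_horizon_Q2.
(* At a real state [with_absorbing] computes to the given policy, so both rewrites hold by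
   conversion. *)
rewrite [LHS](_ : _ = \int[extended_choice G pi (s, c)]_a
  Q_bar pi_bar n.+1 (Some s, c, a))//.
rewrite [RHS](_ : _ = \int[pi (s, c)]_a
  Q (with_absorbing pi eta) n.+1 (Some s, c, a))//.
rewrite /extended_choice; have [Gcs|nGcs] := pselect (G c s).
  rewrite ifT; last exact/asboolP.
  rewrite integral_dirac// diracT mul1e augmented_horizon_Q_stop//.
  rewrite indicE mem_set//.
  under eq_integral do rewrite original_horizon_Q_goal//.
  by rewrite integral_cst// prob_kernel mule1.
rewrite ifF; last exact/asboolPn.
rewrite ge0_integral_push//; last by move=> a; exact: horizon_Q_ge0.
apply: eq_integral => a _.
rewrite augmented_horizon_Q_move// original_horizon_Q_move//; congr (_ * _).
by apply: eq_integral => s' _; exact: (ih (s', c)).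
Qed.

(** The restricted policy is a two-stage draw: [o] from [xi], then an action from [redraw u o]. *)
Lemma integral_restrict_policy (u : probability A R)
    (xi : R.-pker (option S * C) ~> option A) x f :
  (forall a, 0 <= f a) -> measurable_fun [set: A] f ->
  \int[restrict_policy u xi x]_a f a =
  \int[xi (real_state x)]_o \int[redraw u o]_a f a.
Proof.
move=> f0 mf.
exact: (integral_kcomp (kprecomp xi (@measurable_real_state _ _ S C))
  (kprecomp (redraw_kernel u) measurable_snd) x).
Qed.

(** The two-stage form puts both values under the same draw [o] from [xi], so they can be compared
    for each [o]. The argument works for any redrawing law [u]. *)
Lemma restrict_policy_horizon_V (u : probability A R)
    (xi : R.-pker (option S * C) ~> option A) (eta : R.-pker C ~> A) n x :
  V_bar xi n (real_state x) <=
  V (with_absorbing (restrict_policy u xi) eta) n (real_state x).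
Proof.
elim: n x => [|n ih] [s c]; first by rewrite /horizon_V !integral0.
set pi := with_absorbing _ _ in ih *.
have Q0 a : 0 <= Q pi n.+1 (Some s, c, a) by exact: horizon_Q_ge0.
have mQ : measurable_fun setT (fun a => Q pi n.+1 (Some s, c, a)).
  exact: measurable_horizon_Q2.
rewrite [leRHS](integral_restrict_policy u xi (s, c) Q0 mQ).
apply: ge0_le_integral => //.
- by move=> o _; exact: horizon_Q_ge0.
- exact: measurable_horizon_Q2.
- apply: measurable_fun_integral_kernel => // U mU; exact: measurable_redraw.
(* For [Some a] the redraw is a Dirac mass and the [Q] values compare by the induction hypothesis.
   For [None] the augmented value is the goal indicator: in the goal every redrawn action is worth
   1, elsewhere nonnegativity suffices. *)
- case=> [a|] _; rewrite /redraw.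
    by rewrite integral_dirac// diracT mul1e; exact: (le_horizon_Q ih (s, c)).
  rewrite augmented_horizon_Q_stop//.
  have [Gcs|nGcs] := pselect (G c s).
    under eq_integral do rewrite original_horizon_Q_goal//.
    rewrite integral_cst// [X in _ * X](probability_setT u) mule1.
    by rewrite indicE mem_set.
  by rewrite indicE memNset//; exact: integral_ge0.
Qed.

End comparison.

Theorem propositionA3 (R : realType) (dS dA dC : measure_display)
    (S : measurableType dS) (A : measurableType dA) (C : measurableType dC)
    (P : R.-pker (S * A) ~> S)
    (G : C -> set S) (mG : measurable (goal_set G))
    (gamma : R) (gamma_ge0 : (0 <= gamma)%R) (gamma_lt1 : (gamma < 1)%R) :
  (forall (pi : R.-pker (S * C) ~> A)
      (eta : R.-pker C ~> A) (eta_bar : R.-pker C ~> option A),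
    let pi_bar := with_absorbing (extend_policy mG pi) eta_bar in
    (forall (x : S * C) (a : A),
      augmented_Q P G gamma pi_bar (real_state x) (Some a) <=
      original_Q P gamma mG (with_absorbing pi eta) (real_state x) a) /\
    (forall x : S * C,
      original_V P gamma mG (with_absorbing pi eta) (real_state x) =
      augmented_V P G gamma pi_bar (real_state x))) /\
  (forall (mu : {measure set A -> \bar R})
      (mu_gt0 : 0 < mu [set: A]) (mu_fin : mu [set: A] < +oo)
      (xi : R.-pker (option S * C) ~> option A) (eta : R.-pker C ~> A),
    let xi_under :=
      with_absorbing (restrict_policy (uniform_law mu) xi) eta in
    (forall (x : S * C) (a : A),
      augmented_Q P G gamma xi (real_state x) (Some a) <=
      original_Q P gamma mG xi_under (real_state x) a) /\
    (forall x : S * C,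
      augmented_V P G gamma xi (real_state x) <=
      original_V P gamma mG xi_under (real_state x))).
Proof.
split=> [pi eta eta_bar pi_bar|mu mu_gt0 mu_fin xi eta xi_under].
  split=> [|x].
    apply: le_action_value => // n x.
    by rewrite (extend_policy_horizon_V P mG gamma_ge0 pi eta eta_bar).
  rewrite /original_V /augmented_V !state_valueE//.
  (* Both values are limits of truncations that coincide at every horizon. *)
  - congr (lim (_ @ \oo)); apply/funext => n.
    by rewrite (extend_policy_horizon_V P mG gamma_ge0 pi eta eta_bar).
  - exact: augmented_reward_ge0.
  - exact: measurable_augmented_reward.
  - exact: original_reward_ge0.
  - exact: measurable_original_reward.
split=> [|x].
  by apply: le_action_value => // n x; exact: restrict_policy_horizon_V.
by apply: le_state_value => // n; exact: restrict_policy_horizon_V.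
Qed.
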